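(* Let $p=\min(m,n)$, fix $\omega\in(\mathbb{C}^* )^p$, and let $\mathrm{GT}_n^{\le m}(\omega)$ be the subvariety of $\mathrm{GT}_n^{\le m}$ consisting of patterns of shape $\omega$. The action of the geometric crystal operators $\bar e_1^c,\dots,\bar e_{n-1}^c$ ($c\in\mathbb{C}^*$) on $\mathrm{GT}_n^{\le m}(\omega)$ has a dense orbit.
   Context: $\mathrm{GT}_n^{\le m}$ is the torus of arrays $\mathbf{z}=(z_{i,j})$, $z_{i,j}\in\mathbb{C}^*$, $1\le i\le m$, $i\le j\le n$; the shape is $\mathrm{sh}(\mathbf{z})=(z_{1,n},\dots,z_{p,n})$. $E_{a,b}$ denotes a matrix unit, $x_j(a)=I+aE_{j,j+1}$, and for an $n\times n$ matrix $A$ and $I\subseteq[n]$, $\Delta_I(A)$ is the minor with rows $I$ and columns $[1,|I|]$ ($\Delta_\emptyset=1$). Let $W^i(y_i,\dots,y_n)=\sum_{k<i}E_{kk}+\sum_{k\ge i}y_kE_{kk}+\sum_{k=i}^{n-1}E_{k+1,k}$, $\Phi(\mathbf{z})=W^p(z_{p,p},\frac{z_{p,p+1}}{z_{p,p}},\dots,\frac{z_{p,n}}{z_{p,n-1}})\cdots W^1(z_{1,1},\frac{z_{1,2}}{z_{1,1}},\dots,\frac{z_{1,n}}{z_{1,n-1}})$, and $\Psi(A)=(\Delta_{[i,j]}(A)/\Delta_{[i+1,j]}(A))_{1\le i\le m,\,i\le j\le n}$. With $A=\Phi(\mathbf{z})$, set $\bar\varepsilon_j(\mathbf{z})=A_{j+1,j+1}/A_{j+1,j}$,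 $\bar\varphi_j(\mathbf{z})=A_{j,j}/A_{j+1,j}$, and $\bar e_j^c(\mathbf{z})=\Psi\big(x_j((c-1)\bar\varphi_j(\mathbf{z}))\,A\,x_j((c^{-1}-1)\bar\varepsilon_j(\mathbf{z}))\big)$, a rational action of $\mathbb{C}^*$ on $\mathrm{GT}_n^{\le m}$ preserving shape. An orbit is the set of points obtained from one point by repeatedly applying maps $\bar e_j^c$ (with $j\in[n-1]$, $c\in\mathbb{C}^*$, where defined); dense means Zariski dense in $\mathrm{GT}_n^{\le m}(\omega)$. *)

(* Defs.v *)
From mathcomp Require Import all_boot all_algebra.
From mathcomp Require Import Rstruct.
From mathcomp.real_closed Require Import complex.
From mathcomp Require Import mpoly.

Set Implicit Arguments.
Unset Strict Implicit.
Unset Printing Implicit Defensive.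
Import GRing.Theory.
Local Open Scope ring_scope.

Definition C : fieldType := (Rdefinitions.R)[i].

(* All indices below are 0-based: the paper's z_{i,j} is z (i-1) (j-1),
   matrix entry A_{a,b} is A (a-1) (b-1), etc.
   A point of GT_n^{<= m} is stored as a p x n matrix z (p = minn m n),
   with z r c = z_{r+1,c+1} for r <= c, and z r c = 0 for r > c
   (positions that are not coordinates of the torus). *)

Definition getm (k l : nat) (A : 'M[C]_(k, l)) (a b : nat) : C :=
  match @insub _ (fun x => x < k)%N _ a, @insub _ (fun x => x < l)%N _ b with
  | Some a', Some b' => A a' b'
  | _, _ => 0
  end.

Definition inGT (p n : nat) (z : 'M[C]_(p, n)) : Prop :=
  forall (r : 'I_p) (c : 'I_n),
    ((r <= c)%N -> z r c != 0) /\ ((c < r)%N -> z r c = 0).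

Definition inGTw (p n : nat) (omega : 'I_p -> C) (z : 'M[C]_(p, n)) : Prop :=
  inGT z /\ forall (r : 'I_p) (c : 'I_n), (c : nat) = n.-1 -> z r c = omega r.

Definition Wmx (n r : nat) (y : nat -> C) : 'M[C]_n :=
  \matrix_(a < n, b < n)
    if a == b then (if (a < r)%N then 1 else y (a : nat))
    else if (a == b.+1 :> nat) && (r <= b)%N then 1 else 0.

Definition Wargs (p n : nat) (z : 'M[C]_(p, n)) (r : nat) : nat -> C :=
  fun a => if a == r then getm z r a else getm z r a / getm z r a.-1.

Definition Phi (p n : nat) (z : 'M[C]_(p, n)) : 'M[C]_n :=
  \prod_(s < p) Wmx n (p.-1 - s) (Wargs z (p.-1 - s)).

(* Delta_I(A) for I = [i0+1, i0+k] (1-based rows), columns [1,k]; k = 0 gives 1 *)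
Definition minorI (n : nat) (A : 'M[C]_n) (i0 k : nat) : C :=
  \det (\matrix_(a < k, b < k) getm A (i0 + a) b).

Definition Psi (p n : nat) (A : 'M[C]_n) : 'M[C]_(p, n) :=
  \matrix_(r < p, c < n)
    if (r <= c)%N then minorI A r (c - r).+1 / minorI A r.+1 (c - r) else 0.

(* Psi(A) is defined and lands in the torus: all the minors involved are nonzero *)
Definition Psi_ok (p n : nat) (A : 'M[C]_n) : Prop :=
  forall (r : 'I_p) (c : 'I_n), (r <= c)%N ->
    minorI A r (c - r).+1 != 0 /\ minorI A r.+1 (c - r) != 0.

Definition xmx (n j : nat) (t : C) : 'M[C]_n :=
  \matrix_(a < n, b < n)
    ((a == b)%:R + (if (a == j :> nat) && (b == j.+1 :> nat) then t else 0)).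

Definition epsb (p n : nat) (z : 'M[C]_(p, n)) (j : nat) : C :=
  getm (Phi z) j.+1 j.+1 / getm (Phi z) j.+1 j.
Definition phib (p n : nat) (z : 'M[C]_(p, n)) (j : nat) : C :=
  getm (Phi z) j j / getm (Phi z) j.+1 j.

Definition ebar_mx (p n : nat) (z : 'M[C]_(p, n)) (j : nat) (c : C) : 'M[C]_n :=
  xmx n j ((c - 1) * phib z j) *m Phi z *m xmx n j ((c^-1 - 1) * epsb z j).

Definition ebar (p n : nat) (z : 'M[C]_(p, n)) (j : nat) (c : C) : 'M[C]_(p, n) :=
  Psi p (ebar_mx z j c).

(* bar-e_{j+1}^c is defined at z: the divisions by A_{j+2,j+1} and by the
   minors Delta_{[r+2,c+1]} make sense, and the value lies in the torus *)
Definition ebar_defined (p n : nat) (z : 'M[C]_(p, n)) (j : nat) (c : C) : Prop :=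
  getm (Phi z) j.+1 j != 0 /\ Psi_ok p (ebar_mx z j c).

Definition ebar_step (p n : nat) (z z' : 'M[C]_(p, n)) : Prop :=
  exists (j : nat) (c : C),
    [/\ (j < n.-1)%N, c != 0, ebar_defined z j c & z' = ebar z j c].

Inductive ebar_orbit (p n : nat) (z0 : 'M[C]_(p, n)) : 'M[C]_(p, n) -> Prop :=
  | orbit_refl : ebar_orbit z0 z0
  | orbit_step z z' : ebar_orbit z0 z -> ebar_step z z' -> ebar_orbit z0 z'.

Definition evalpt (p n : nat) (P : {mpoly C[p * n]}) (z : 'M[C]_(p, n)) : C :=
  P.@[fun k => mxvec z 0 k].

Definition zariski_dense_in_GTw (p n : nat) (omega : 'I_p -> C)
    (S : 'M[C]_(p, n) -> Prop) : Prop :=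
  forall P : {mpoly C[p * n]},
    (forall z, S z -> evalpt P z = 0) ->
    forall z, inGTw omega z -> evalpt P z = 0.

(* Main.v *)
(* (Indices start at 1 in this comment, as in the paper, and at 0 below.)
   Left multiplication by [x_j(a)] moves through the factors of [Phi z] from left to
   right, so [\bar e_j^c] only changes column [j] of a pattern, along a curve that is
   rational in [a] and starts at [z] for [a = 0] ([flow], [jet_flow]). Its velocity in the
   coordinate [z_{i,j}] is a nonzero factor depending on columns [j] and [j+1] only, times
   the product of the [z_{s,j-1}] for [s >= i], [s < j]: these are distinct monomials in
   column [j-1], hence linearly independent.

   Density follows by induction on [k]: the operators [\bar e_j], [j <= k], are dense on
   the set of patterns with prescribed columns beyond [k]. If [P] vanishes on the orbit
   then, by the induction hypothesis, it vanishes on the whole fiber over each value of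
   column [k+1] that the orbit reaches. Differentiating along [\bar e_{k+1}] and varying
   column [k] in the orbit, all partial derivatives of [P] along column [k+1] have
   the same property. By induction on the degree they vanish, so [P] is constant along
   column [k+1], and therefore zero.

   To keep the operators defined, only orbits through patterns for which all subdiagonal
   entries of [Phi z] are nonzero ([nondeg]) are followed. *)

Require Import Defs.
From mathcomp Require Import all_boot all_algebra.
From mathcomp Require Import ring zify.
From mathcomp Require Import Rstruct.
From mathcomp.real_closed Require Import complex.
From mathcomp Require Import mpoly.
Set Implicit Arguments.
Unset Strict Implicit.
Unset Printing Implicit Defensive.
Import GRing.Theory.
Local Open Scope ring_scope.

(** * One-variable polynomials and rational functions near [0] *)

Lemma natrC_neq0 (n : nat) : (n.+1%:R : C) != 0.
Proof. exact: (@Num.Theory.lt0r_neq0 (Rdefinitions.R[i]) _ (Num.Theory.ltr0Sn _ _)). Qed.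

Definition horner_simp := (hornerXn, hornerD, hornerN, hornerC, hornerX, hornerM).

Lemma poly_vanish_eq0 (p : {poly C}) : (forall a, p.[a] = 0) -> p = 0.
Proof.
move=> p0; apply/eqP/negPn/negP => pN0.
pose s := [seq i%:R : C | i <- iota 0 (size p)].
have us : uniq s.
  rewrite map_inj_in_uniq ?iota_uniq // => i j _ _.
  wlog le_ij : i j / (i <= j)%N => [W eq_ij|].
    by case/orP: (leq_total i j) => h; [exact: W | exact/esym/W].
  move/eqP; rewrite eq_sym -subr_eq0 -natrB //.
  case e: (j - i)%N => [|d]; first by move=> _; lia.
  by rewrite (negbTE (natrC_neq0 d)).
have rs : all (root p) s by apply/allP => x _; apply/eqP.
by have := max_poly_roots pN0 rs us; rewrite size_map size_iota ltnn.
Qed.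

(** [S] contains a Zariski neighbourhood of [0] in the affine line. *)
Definition near0 (S : C -> Prop) :=
  exists2 q : {poly C}, q.[0] != 0 & forall a, q.[a] != 0 -> S a.

Lemma near0T (S : C -> Prop) : (forall a, S a) -> near0 S.
Proof. by move=> h; exists 1; rewrite ?hornerC ?oner_eq0. Qed.

Lemma near0W (S T : C -> Prop) : (forall a, S a -> T a) -> near0 S -> near0 T.
Proof. by move=> ST [q q0 h]; exists q => // a /h /ST. Qed.

Lemma near0I (S T : C -> Prop) :
  near0 S -> near0 T -> near0 (fun a => S a /\ T a).
Proof.
case=> q q0 h [r r0 k]; exists (q * r); first by rewrite hornerM mulf_neq0.
by move=> a; rewrite hornerM mulf_eq0 negb_or => /andP[/h ? /k].
Qed.

Lemma near0_seq (I : eqType) (s : seq I) (S : I -> C -> Prop) :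
  {in s, forall i, near0 (S i)} -> near0 (fun a => {in s, forall i, S i a}).
Proof.
elim: s => [|i s IHs] h; first by apply: near0T => a i; rewrite in_nil.
have hs : {in s, forall j, near0 (S j)}.
  by move=> j js; apply: h; rewrite inE js orbT.
have := near0I (h i (mem_head _ _)) (IHs hs).
apply: near0W => a [Si Ss] j.
by rewrite inE => /predU1P[-> //|/Ss].
Qed.

Lemma near0_all (I : finType) (S : I -> C -> Prop) :
  (forall i, near0 (S i)) -> near0 (fun a => forall i, S i a).
Proof.
move=> h; have := @near0_seq _ (enum I) S (fun i _ => h i).
by apply: near0W => a Sa i; apply: Sa; rewrite mem_enum.
Qed.

(** The product of [p] with the polynomial cutting out the exceptional points vanishes
    everywhere. *)
Lemma near0_poly_eq0 (p : {poly C}) : near0 (fun a => p.[a] = 0) -> p = 0.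
Proof.
case=> q q0 h; have /poly_vanish_eq0/eqP : forall a, (q * p).[a] = 0.
  move=> a; rewrite hornerM; have [->|/h ->] := eqVneq q.[a] 0;
  by rewrite ?mul0r ?mulr0.
rewrite mulf_eq0 => /orP[/eqP e|/eqP //].
by rewrite e horner0 eqxx in q0.
Qed.

(* [f] agrees, away from finitely many nonzero points, with a rational function
   regular at [0] whose value and derivative there are [v] and [d]. *)
Definition jet (f : C -> C) (v d : C) := exists q r : {poly C},
  q.[0] != 0 /\ forall a, q.[a] != 0 -> f a = v + d * a + a ^+ 2 * (r.[a] / q.[a]).

Lemma jet_near (f g : C -> C) v d :
  jet f v d -> near0 (fun a => f a = g a) -> jet g v d.
Proof.
case=> q [r [q0 h]] [u u0 k]; exists (q * u), (r * u); split.
  by rewrite hornerM mulf_neq0.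
move=> a; rewrite !hornerM mulf_eq0 negb_or => /andP[qa ua].
by rewrite -k // h //; field; rewrite qa ua.
Qed.

Lemma jet_eq (f : C -> C) v d v' d' : jet f v d -> v = v' -> d = d' -> jet f v' d'.
Proof. by move=> h <- <-. Qed.

Lemma jet_const (v : C) : jet (fun=> v) v 0.
Proof.
exists 1, 0; split; first by rewrite hornerC oner_eq0.
by move=> a _; rewrite horner0; ring.
Qed.

Lemma jet_id : jet id 0 1.
Proof.
exists 1, 0; split; first by rewrite hornerC oner_eq0.
by move=> a _; rewrite horner0; ring.
Qed.

Lemma jetD (f g : C -> C) v d w e :
  jet f v d -> jet g w e -> jet (fun a => f a + g a) (v + w) (d + e).
Proof.
case=> q [r [q0 h]] [u [s [u0 k]]]; exists (q * u), (r * u + s * q); split.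
  by rewrite hornerM mulf_neq0.
move=> a; rewrite hornerD !hornerM mulf_eq0 negb_or => /andP[qa ua].
by rewrite h // k //; field; rewrite qa ua.
Qed.

Lemma jetM (f g : C -> C) v d w e :
  jet f v d -> jet g w e -> jet (fun a => f a * g a) (v * w) (d * w + v * e).
Proof.
case=> q [r [q0 h]] [u [s [u0 k]]].
(* The terms of order at least two in the product of the expansions, over the denominator
   [q * u]. *)
exists (q * u), (d%:P * e%:P * q * u + (v%:P + d%:P * 'X) * s * q
  + (w%:P + e%:P * 'X) * r * u + 'X ^+ 2 * r * s); split.
  by rewrite hornerM mulf_neq0.
move=> a; rewrite !horner_simp mulf_eq0 negb_or => /andP[qa ua].
by rewrite h // k //; field; rewrite qa ua.
Qed.

Lemma jet_neq0 (f : C -> C) v d : jet f v d -> v != 0 -> near0 (fun a => f a != 0).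
Proof.
case=> q [r [q0 h]] v0.
exists (q * ((v%:P + d%:P * 'X) * q + 'X ^+ 2 * r)).
  by rewrite !horner_simp expr0n /= !(mul0r, mulr0, addr0) !mulf_neq0.
move=> a; rewrite !horner_simp mulf_eq0 negb_or => /andP[qa ua].
rewrite h //; apply: contraNneq ua => e; rewrite -(mulr0 q.[a]) -e; apply/eqP.
by field.
Qed.

Lemma jetV (f : C -> C) v d :
  jet f v d -> v != 0 -> jet (fun a => (f a)^-1) v^-1 (- d / v ^+ 2).
Proof.
move=> J v0; have [u u0 k] := jet_neq0 J v0; case: J => q [r [q0 h]].
(* With [F = (v + d X) q + X^2 r], so that [f = F / q], the remainder [q / F - 1 / v + d a / v^2] is
   [a^2 (- r / v + d^2 q / v^2 + d a r / v^2) / F]. *)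
exists (u * ((v%:P + d%:P * 'X) * q + 'X ^+ 2 * r) * q),
  (u * q * (- r * (v^-1)%:P + (d ^+ 2 / v ^+ 2)%:P * q + (d / v ^+ 2)%:P * 'X * r)); split.
  rewrite !horner_simp expr0n /= !(mul0r, mulr0, addr0).
  by rewrite !mulf_neq0.
move=> a; rewrite !horner_simp !mulf_eq0 !negb_or => /andP[/andP[ua fa] qa].
have := k a ua; rewrite h // => f0.
by field; rewrite qa fa ua v0.
Qed.

(** The numerator of [f] is the zero polynomial: its value at [0] gives [v = 0], and dividing it by
    [X] then gives [d = 0]. *)
Lemma jet_eq0 (f : C -> C) v d : jet f v d -> near0 (fun a => f a = 0) -> d = 0.
Proof.
case=> q [r [q0 h]] [u u0 k].
have /near0_poly_eq0 e : near0 (fun a => ((v%:P + d%:P * 'X) * q + 'X ^+ 2 * r).[a] = 0).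
  exists (q * u); first by rewrite hornerM mulf_neq0.
  move=> a; rewrite !horner_simp mulf_eq0 negb_or => /andP[qa ua].
  by have := k a ua; rewrite h // => e; rewrite -(mulr0 q.[a]) -e; field.
have v0 : v = 0.
  have := congr1 (fun p => p.[0]) e; rewrite !horner_simp expr0n /= !(mul0r, mulr0, addr0).
  by move/eqP; rewrite mulf_eq0 (negbTE q0) orbF => /eqP.
have : 'X * (d%:P * q + 'X * r) = 0 by rewrite -e v0 polyC0; ring.
move/eqP; rewrite mulf_eq0 polyX_eq0 /= => /eqP /(congr1 (fun p => p.[0])).
rewrite !horner_simp ?mul0r ?addr0 => /eqP.
by rewrite mulf_eq0 (negbTE q0) orbF => /eqP.
Qed.

(** * Polynomials in several variables along curves and lines *)

Lemma subUU N (i : 'I_N) : (U_(i) - U_(i))%MM = 0%MM.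
Proof. by apply/mnmP => j; rewrite mnmBE subnn mnm0E. Qed.

(** Chain rules respect sums and products, so it is enough to check them on constants and
    variables. *)
Lemma mpoly_ring_ind N (K : {mpoly C[N]} -> Prop) :
  (forall c, K c%:MP) -> (forall i, K 'X_i) ->
  (forall p q, K p -> K q -> K (p + q)) ->
  (forall p q, K p -> K q -> K (p * q)) -> forall p, K p.
Proof.
move=> KC KX KD KM; elim/mpolyind => [|c m p _ _ Kp]; first by rewrite -mpolyC0.
apply: (KD) => //; rewrite -mul_mpolyC mpolyXE_id; apply: (KM) => //.
apply: big_ind => [||i _]; [by rewrite -mpolyC1 | exact: KM |].
by elim: (m i) => [|k IHk]; rewrite ?exprS ?expr0; [rewrite -mpolyC1 | exact: KM].
Qed.

Lemma jet_meval N (P : {mpoly C[N]}) (f : 'I_N -> C -> C) (v d : 'I_N -> C) :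
  (forall i, jet (f i) (v i) (d i)) ->
  jet (fun a => P.@[f^~ a]) P.@[v] (\sum_i d i * (P^`M(i)).@[v]).
Proof.
move=> h; elim/mpoly_ring_ind: P => [c|k|p q Jp Jq|p q Jp Jq].
- apply: jet_near (jet_eq (jet_const c) _ _) (near0T _) => [||a]; rewrite ?mevalC //.
  by rewrite big1 // => i _; rewrite mderivC meval0 mulr0.
- apply: jet_near (jet_eq (h k) _ _) (near0T _) => [||a]; rewrite ?mevalXU //.
  rewrite (bigD1 k) //= big1 => [|i ik]; rewrite mderivX mnmE.
    by rewrite eqxx scale1r subUU mpolyX0 meval1 mulr1 addr0.
  by rewrite eq_sym (negbTE ik) scale0r meval0 mulr0.
- apply: jet_near (jet_eq (jetD Jp Jq) _ _) (near0T _) => [||a]; rewrite ?mevalD //.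
  by rewrite -big_split /=; apply: eq_bigr => i _; rewrite mderivD mevalD mulrDr.
apply: jet_near (jet_eq (jetM Jp Jq) _ _) (near0T _) => [||a]; rewrite ?mevalM //.
rewrite mulr_suml mulr_sumr -big_split /=; apply: eq_bigr => i _.
by rewrite mderivM mevalD !mevalM; ring.
Qed.

(** The restriction of [P] to the line through [w] with direction [e]. *)
Definition mpoly_along N (w e : 'I_N -> C) (P : {mpoly C[N]}) : {poly C} :=
  mmap polyC (fun i => (w i)%:P + e i *: 'X) P.

Lemma horner_along N (w e : 'I_N -> C) (P : {mpoly C[N]}) t :
  (mpoly_along w e P).[t] = P.@[fun i => w i + e i * t].
Proof.
rewrite /mpoly_along; elim/mpoly_ring_ind: P => [c|k|p q Jp Jq|p q Jp Jq].
- by rewrite mmapC hornerC mevalC.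
- by rewrite mmapX mmap1U mevalXU hornerD hornerC hornerZ hornerX.
- by rewrite mmapD hornerD Jp Jq mevalD.
by rewrite rmorphM hornerM Jp Jq mevalM.
Qed.

Lemma deriv_along N (w e : 'I_N -> C) (P : {mpoly C[N]}) :
  (mpoly_along w e P)^`() = \sum_i e i *: mpoly_along w e P^`M(i).
Proof.
rewrite /mpoly_along; elim/mpoly_ring_ind: P => [c|k|p q Jp Jq|p q Jp Jq].
- by rewrite mmapC derivC big1 // => i _; rewrite mderivC mmap0 scaler0.
- rewrite mmapX mmap1U derivD derivC derivZ derivX add0r.
  rewrite (bigD1 k) //= big1 => [|i ik]; rewrite mderivX mnmE.
    by rewrite eqxx scale1r subUU mpolyX0 rmorph1 addr0.
  by rewrite eq_sym (negbTE ik) scale0r mmap0 scaler0.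
- rewrite mmapD derivD Jp Jq -big_split /=; apply: eq_bigr => i _.
  by rewrite mderivD mmapD scalerDr.
rewrite rmorphM derivM Jp Jq mulr_suml mulr_sumr -big_split /=.
apply: eq_bigr => i _.
by rewrite mderivM mmapD !rmorphM scalerDr -scalerAl -scalerAr.
Qed.

Lemma deriv_eq0_horner (p : {poly C}) a b : p^`() = 0 -> p.[a] = p.[b].
Proof.
move=> dp; suff -> : p = (p`_0)%:P by rewrite !hornerC.
apply/polyP => -[|i]; rewrite coefC //=.
have := congr1 (fun q : {poly C} => q`_i) dp; rewrite coef_deriv coef0 -mulr_natr.
by move/eqP; rewrite mulf_eq0 (negbTE (natrC_neq0 i)) orbF => /eqP.
Qed.

Lemma msize_mderiv N (P : {mpoly C[N]}) i : (msize P^`M(i) <= (msize P).-1)%N.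
Proof.
rewrite msizeE; apply/bigmax_leqP_seq => m; rewrite mcoeff_msupp mcoeff_mderiv => mP _.
have : (m + U_(i))%MM \in msupp P.
  by rewrite mcoeff_msupp; apply: contraNneq mP => ->; rewrite mul0rn.
by move/msize_mdeg_lt; rewrite mdegD mdeg1; lia.
Qed.

(** * Moving [x_j(t)] through a factor [W] *)

Lemma getmE k l (A : 'M[C]_(k, l)) (i : 'I_k) (j : 'I_l) : getm A i j = A i j.
Proof. by rewrite /getm !valK. Qed.

Lemma getm_out k l (A : 'M[C]_(k, l)) a b : ((k <= a) || (l <= b))%N -> getm A a b = 0.
Proof.
rewrite /getm; case: insubP => //= i ai _; case: insubP => //= j bj _.
by case/orP; rewrite leqNgt ?ai ?bj.
Qed.

Lemma mul_xmxE k n (M : 'M[C]_(k, n)) j t a b :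
  (M *m xmx n j t) a b = M a b + (if b == j.+1 :> nat then t * getm M a j else 0).
Proof.
rewrite !mxE; under eq_bigr do rewrite mxE mulrDr; rewrite big_split /=; congr (_ + _).
  rewrite (bigD1 b) //= eqxx mulr1 big1 ?addr0 // => i /negbTE ->; exact: mulr0.
have [bj|bj] := eqVneq (b : nat) j.+1; last by rewrite big1 // => i _; rewrite andbF mulr0.
have jn : (j < n)%N by have := ltn_ord b; lia.
rewrite (bigD1 (Ordinal jn)) //= eqxx mulrC -[M a (Ordinal jn)]getmE.
by rewrite big1 ?addr0 // => i /negbTE; rewrite -val_eqE /= andbT => ->; rewrite mulr0.
Qed.

Lemma xmx_mulE k n (M : 'M[C]_(n, k)) j t a b : (j.+1 < n)%N ->
  (xmx n j t *m M) a b = M a b + (if a == j :> nat then t * getm M j.+1 b else 0).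
Proof.
move=> jn; rewrite !mxE; under eq_bigr do rewrite mxE mulrDl.
rewrite big_split /=; congr (_ + _).
  rewrite (bigD1 a) //= eqxx mul1r big1 ?addr0 // => i.
  by rewrite eq_sym => /negbTE ->; exact: mul0r.
have [bj|bj] := eqVneq (a : nat) j; last by rewrite big1 // => i _; rewrite mul0r.
rewrite (bigD1 (Ordinal jn)) //= eqxx -[M (Ordinal jn) b]getmE.
by rewrite big1 ?addr0 // => i /negbTE; rewrite -val_eqE /= => ->; rewrite mul0r.
Qed.

Lemma getm_mul_xmx k n (M : 'M[C]_(k, n)) j t a b : (j.+1 < n)%N ->
  getm (M *m xmx n j t) a b = getm M a b + (if b == j.+1 then t * getm M a j else 0).
Proof.
move=> jn; have [ak|ka] := ltnP a k; last by rewrite !getm_out ?ka // mulr0 if_same addr0.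
have [bn|nb] := ltnP b n; last first.
  by rewrite [LHS]getm_out ?[getm M a b]getm_out ?nb ?orbT // ifN ?addr0 //; lia.
rewrite [LHS](getmE _ (Ordinal ak) (Ordinal bn)) mul_xmxE /=.
  by rewrite -[M _ _]getmE.
Qed.

Lemma getm_mul_Wmx k n (M : 'M[C]_(k, n)) r y a b :
  getm (M *m Wmx n r y) a b =
    getm M a b * (if (b < r)%N then 1 else y b) + (if (r <= b)%N then getm M a b.+1 else 0).
Proof.
have [ak|ka] := ltnP a k; last by rewrite !getm_out ?ka // mul0r if_same addr0.
have [bn|nb] := ltnP b n; last first.
  by rewrite !getm_out ?nb ?(leqW nb) ?orbT // mul0r if_same addr0.
rewrite [LHS](getmE _ (Ordinal ak) (Ordinal bn)) mxE
  -[getm M a b]/(getm M (Ordinal ak) (Ordinal bn)) getmE -[a]/(nat_of_ord (Ordinal ak)).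
rewrite (bigD1 (Ordinal bn)) //= mxE eqxx; congr (_ + _).
have z : forall i : 'I_n, i != Ordinal bn -> i != b.+1 :> nat ->
    M (Ordinal ak) i * Wmx n r y i (Ordinal bn) = 0.
  by move=> i /negbTE ib /negbTE ib1; rewrite mxE ib ib1 mulr0.
have [b1n|nb1] := ltnP b.+1 n; last first.
  rewrite big1 => [|i ib]; last by apply: z => //; have := ltn_ord i; lia.
  by rewrite getm_out ?nb1 ?orbT // if_same.
rewrite (bigD1 (Ordinal b1n)) //=; last by rewrite -val_eqE /=; lia.
rewrite big1 => [|i /andP[ib ib1]]; last by apply: z.
rewrite mxE -val_eqE /= eqn_leq ltnn /= eqxx /= addr0 -[M (Ordinal ak) (Ordinal b1n)]getmE.
by case: ifP => _; rewrite ?mulr1 ?mulr0.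
Qed.

Lemma det_xmx n j t : \det (xmx n j t) = 1.
Proof.
rewrite -det_tr det_trig.
  apply: big1 => i _; rewrite !mxE eqxx; case: ifP => [|_]; last by rewrite addr0.
  by move=> /andP[/eqP->]; lia.
apply/is_trig_mxP => a b ab; rewrite !mxE -val_eqE /= [_ == _](_ : _ = false); last by lia.
by rewrite ifN ?addr0 //; lia.
Qed.

(* The minors use the leading columns, which right multiplication by [x_j] alters
   by a unitriangular column operation. *)
Lemma minorI_mul_xmx n (A : 'M[C]_n) j t i0 k : (j.+1 < n)%N ->
  minorI (A *m xmx n j t) i0 k = minorI A i0 k.
Proof.
move=> jn; rewrite /minorI -[RHS]mulr1 -(det_xmx k j t) -det_mulmx; congr (\det _).
apply/matrixP => a b; rewrite mul_xmxE [LHS]mxE getm_mul_xmx // [in RHS]mxE; congr (_ + _).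
case: ifP => // /eqP bj; have jk : (j < k)%N by have := ltn_ord b; lia.
by rewrite -[j in RHS]/(nat_of_ord (Ordinal jk)) getmE mxE.
Qed.

(** [push_args] and [push_param] solve [x_j(t) W^r(y) = W^r(y') x_j(t')] for [y'] and [t']. For
    [r <= j] the product of the arguments [j] and [j.+1] is preserved. *)
Definition push_args (r j : nat) (t : C) (y : nat -> C) : nat -> C := fun a =>
  if (r <= j)%N then
    if a == j then y j + t else if a == j.+1 then y j.+1 * y j / (y j + t) else y a
  else y a.

Definition push_param (r j : nat) (t : C) (y : nat -> C) : C :=
  if (r <= j)%N then t * y j.+1 / (y j + t) else if r == j.+1 then t * y j.+1 else t.

Lemma getm_Wmx n r y a b : (a < n)%N -> (b < n)%N ->
  getm (Wmx n r y) a b =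
    if a == b then (if (a < r)%N then 1 else y a)
    else if (a == b.+1) && (r <= b)%N then 1 else 0.
Proof.
move=> an bn; rewrite [LHS](getmE _ (Ordinal an) (Ordinal bn)) mxE -val_eqE //=.
Qed.

Lemma xmx_mul_Wmx n r j t y : (j.+1 < n)%N -> ((r <= j)%N -> y j + t != 0) ->
  xmx n j t *m Wmx n r y = Wmx n r (push_args r j t y) *m xmx n j (push_param r j t y).
Proof.
move=> jn y0; apply/matrixP => a b; rewrite xmx_mulE // mul_xmxE.
rewrite -[Wmx _ _ y a b]getmE -[Wmx _ _ (push_args _ _ _ _) a b]getmE.
rewrite !getm_Wmx ?(ltnW jn) //.
move: (nat_of_ord a) (nat_of_ord b) => {}a {}b {jn}.
rewrite /push_args /push_param.
(* Only rows and columns [j] and [j.+1] are special, so nine cases remain for each position of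
   [r]. *)
have cases : forall i, [\/ i = j, i = j.+1 | (i != j) && (i != j.+1)].
  move=> i; have [->|ij] := eqVneq i j; first by apply: Or31.
  by have [->|ij1] := eqVneq i j.+1; [apply: Or32 | apply: Or33].
have eS i : (i == i.+1) = false by lia.
have eS' i : (i.+1 == i) = false by lia.
have sE := (eqSS, eqxx, eS, eS', addr0, mul0r, mulr0).
have [rj|jr] := leqP r j.
  have {}y0 := y0 rj; have r1 : (j < r)%N = false by lia.
  have r2 : (r <= j.+1)%N by lia.
  have r3 : (j.+1 < r)%N = false by lia.
  case: (cases a) => [->|->|/andP[/negbTE aj /negbTE aj1]];
  case: (cases b) => [->|->|/andP[/negbTE bj /negbTE bj1]];
    rewrite ?sE ?aj ?aj1 ?bj ?bj1 ?[j.+1 == b]eq_sym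
      ?[j == b]eq_sym ?sE ?bj ?bj1 ?r1 ?r2 ?r3 ?rj ?mulr1 /= ?sE //; by field.
have [->|rj1] := eqVneq r j.+1.
  case: (cases a) => [->|->|/andP[/negbTE aj /negbTE aj1]];
  case: (cases b) => [->|->|/andP[/negbTE bj /negbTE bj1]];
    rewrite ?sE ?aj ?aj1 ?bj ?bj1 ?[j.+1 == b]eq_sym
      ?[j == b]eq_sym ?sE ?bj ?bj1 ?ltnn ?leqnn ?ltnSn /= ?sE //; by ring.
have r1 : (j.+1 < r)%N by lia.
have r2 : (r <= j)%N = false by lia.
have r3 : (r <= j.+1)%N = false by lia.
case: (cases a) => [->|->|/andP[/negbTE aj /negbTE aj1]];
case: (cases b) => [->|->|/andP[/negbTE bj /negbTE bj1]];
  rewrite ?sE ?aj ?aj1 ?bj ?bj1 ?[j.+1 == b]eq_sym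
      ?[j == b]eq_sym ?sE ?bj ?bj1 ?r1 ?r2 ?r3 ?jr ?(negbTE rj1) /= ?sE //; by ring.
Qed.

Lemma Wmx_eq n r (y y' : nat -> C) :
  (forall a, (r <= a < n)%N -> y a = y' a) -> Wmx n r y = Wmx n r y'.
Proof.
move=> yy'; apply/matrixP => a b; rewrite !mxE; case: eqP => // _.
by case: ltnP => // ra; apply: yy'; rewrite ra ltn_ord.
Qed.

(** Hence [ebar] can be computed from the product of the first two factors of [ebar_mx]. *)
Lemma Psi_mul_xmx p n (A : 'M[C]_n) j t : (j.+1 < n)%N -> Psi p (A *m xmx n j t) = Psi p A.
Proof. by move=> jn; apply/matrixP => r c; rewrite !mxE !minorI_mul_xmx. Qed.

Lemma Psi_ok_mul_xmx p n (A : 'M[C]_n) j t :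
  (j.+1 < n)%N -> Psi_ok p A -> Psi_ok p (A *m xmx n j t).
Proof. by move=> jn ok r c rc; rewrite !minorI_mul_xmx //; exact: ok. Qed.

Lemma getm_xmx_mul k n (M : 'M[C]_(n, k)) j t a b : (j.+1 < n)%N ->
  getm (xmx n j t *m M) a b = getm M a b + (if a == j then t * getm M j.+1 b else 0).
Proof.
move=> jn; have [an|na] := ltnP a n; last first.
  by rewrite !(@getm_out n k _ a) ?na // ifN ?addr0 //; lia.
have [bk|kb] := ltnP b k; last first.
  by rewrite !(@getm_out n k _ _ b) ?kb ?orbT // mulr0 if_same addr0.
by rewrite [LHS](getmE _ (Ordinal an) (Ordinal bk)) xmx_mulE // -getmE.
Qed.

(** * Partial products of [Phi z], their entries and minors *)

Section Pattern.
Variables (p n : nat).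
Hypothesis p_le_n : (p <= n)%N.
Implicit Type z : 'M[C]_(p, n).

Definition Wprod z k : 'M[C]_n := \prod_(s < k) Wmx n (p.-1 - s) (Wargs z (p.-1 - s)).

Lemma WprodS z k : Wprod z k.+1 = Wprod z k *m Wmx n (p.-1 - k) (Wargs z (p.-1 - k)).
Proof. by rewrite /Wprod big_ord_recr. Qed.

Lemma getm1 a b : getm (1%:M : 'M[C]_n) a b = ((a == b) && (a < n)%N)%:R.
Proof.
have [an|na] := ltnP a n; last by rewrite getm_out ?na // andbF.
have [bn|nb] := ltnP b n; last by rewrite getm_out ?nb ?orbT //; case: eqP => //=; lia.
by rewrite (_ : a = Ordinal an) // (_ : b = Ordinal bn) // getmE mxE -val_eqE /= andbT.
Qed.

(** A factor of row [r] changes only the columns from [r] on, and the rows used so far are at least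
    [p - k]. *)
Lemma Wprod_left z k a b : (k <= p)%N -> (b < p - k)%N ->
  getm (Wprod z k) a b = ((a == b) && (a < n)%N)%:R.
Proof.
elim: k => [|k IHk] kp bk; first by rewrite /Wprod big_ord0 getm1.
by rewrite WprodS getm_mul_Wmx ifT ?ifN ?IHk ?mulr1 ?addr0 //; lia.
Qed.

Lemma Wprod_trig z k a b : (a < b)%N -> getm (Wprod z k) a b = 0.
Proof.
elim: k b => [|k IHk] b ab; first by rewrite /Wprod big_ord0 getm1; case: eqP => //; lia.
by rewrite WprodS getm_mul_Wmx !IHk ?mul0r ?if_same ?addr0 //; lia.
Qed.

Definition Wdiag z r a := if (a < r)%N then 1 else Wargs z r a.

Lemma Wprod_diag z k a : (k <= p)%N -> (a < n)%N ->
  getm (Wprod z k) a a = \prod_(p - k <= r < p) Wdiag z r a.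
Proof.
move=> + an; elim: k => [|k IHk] kp.
  by rewrite /Wprod big_ord0 getm1 eqxx an subn0 big_geq.
rewrite WprodS getm_mul_Wmx IHk; last by lia.
rewrite (Wprod_trig z k (ltnSn a)) if_same addr0 mulrC.
rewrite [RHS]big_ltn; last by lia.
have -> : (p.-1 - k)%N = (p - k.+1)%N by lia.
by have -> : (p - k)%N = (p - k.+1).+1 by lia.
Qed.

Lemma getm_inGT z r c : inGT z -> (r < p)%N -> (c < n)%N -> (r <= c)%N -> getm z r c != 0.
Proof.
move=> zGT rp cn rc; rewrite (_ : r = Ordinal rp) // (_ : c = Ordinal cn) // getmE.
exact: (zGT _ _).1.
Qed.

Lemma Wargs_neq0 z r a : inGT z -> (r < p)%N -> (a < n)%N -> (r <= a)%N -> Wargs z r a != 0.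
Proof.
move=> zGT rp an ra; rewrite /Wargs; case: (eqVneq a r) => [_|ne]; first exact: getm_inGT.
by apply: mulf_neq0; rewrite ?invr_eq0; apply: getm_inGT => //; lia.
Qed.

(** If [i = p - k], the block is triangular and the quotients on its diagonal telescope along each
    row of [z]. If [i > p - k], the last factor acts on the block of the previous product by a
    unitriangular column operation, so the minor is unchanged. *)
Lemma minor_Wprod z k i l : inGT z -> (k <= p)%N -> (p - k <= i <= p)%N -> (i + l <= n)%N ->
  \det (\matrix_(a < l, b < l) getm (Wprod z k) (i + a) (p - k + b)) =
  \prod_(i <= r < p) (if (r < i + l)%N then getm z r (i + l).-1 else 1).
Proof.
move=> zGT; elim: k => [|k IHk] kp ikp il.
  have -> : i = p by lia.
  rewrite subn0 big_geq // det_trig; last first.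
    by apply/is_trig_mxP => a b ab; rewrite mxE Wprod_trig // ltn_add2l.
  apply: big1 => a _; rewrite mxE /Wprod big_ord0 getm1 eqxx /= (_ : (p + a < n)%N) //.
  by have := ltn_ord a; lia.
have [ir|ir] := eqVneq i (p - k.+1)%N.
  rewrite -ir det_trig; last first.
    by apply/is_trig_mxP => a b ab; rewrite mxE Wprod_trig // ltn_add2l.
  under [LHS]eq_bigr do rewrite mxE.
  clear IHk; elim: l il => [|l IHl] il.
    by rewrite big_ord0 big_nat big1 // => r /andP[ri _]; rewrite ifN //; lia.
  rewrite big_ord_recr /= IHl; last by lia.
  rewrite Wprod_diag -?ir -?big_split /=; [|lia..].
  rewrite big_nat [RHS]big_nat; apply: eq_bigr => r /andP[ri rp].
  rewrite addnS /= /Wdiag /Wargs.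
  rewrite ltnS; case: (ltngtP r (i + l)%N) => h; rewrite ?mul1r ?mulr1 //.
    by rewrite mulrC divfK //; apply: getm_inGT => //; lia.
have {}ikp : (p - k <= i <= p)%N by lia.
rewrite -IHk //; last by lia.
have -> : (p - k)%N = (p - k.+1).+1 by lia.
rewrite -[RHS]mulr1.
pose U : 'M[C]_l := \matrix_(a, b)
  ((a == b)%:R + if a.+1 == b :> nat then Wargs z (p - k.+1) (p - k.+1 + b) else 0).
have detU : \det U = 1.
  rewrite -det_tr det_trig.
    by apply: big1 => a _; rewrite !mxE eqxx eqn_leq ltnn /= addr0.
  apply/is_trig_mxP => a b ab; rewrite !mxE -val_eqE /= [_ == _](_ : _ = false); last by lia.
  by rewrite ifN ?addr0 //; lia.
rewrite -detU -det_mulmx; congr (\det _); apply/matrixP => a b.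
rewrite [LHS]mxE WprodS (_ : p.-1 - k = p - k.+1)%N; last by lia.
rewrite getm_mul_Wmx leq_addr ltnNge leq_addr /= [RHS]mxE.
under eq_bigr do rewrite !mxE mulrDr.
rewrite big_split /= addrC; congr (_ + _); last first.
  rewrite (bigD1 b) //= eqxx mulr1 addSn big1 ?addr0 // => c /negbTE ->; exact: mulr0.
(* The first column receives a multiple of column [p - k.+1] of the previous product, an identity
   column that vanishes on the rows from [i] on. *)
have [b0|b0] := posnP b.
  rewrite b0 addn0 Wprod_left; [|lia..].
  rewrite [_ == _](_ : _ = false) /=; last by lia.
  by rewrite mul0r big1 // => c _; rewrite mulr0.
have bl : (b.-1 < l)%N by have := ltn_ord b; lia.
rewrite (bigD1 (Ordinal bl)) //= prednK // eqxx big1 ?addr0 => [|c].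
  by congr (getm _ _ _ * _); lia.
by rewrite -val_eqE /= => cb; rewrite ifN ?mulr0 //; lia.
Qed.

Lemma WprodE z : Wprod z p = Phi z. Proof. by []. Qed.

Lemma minor_Phi z i l : inGT z -> (i <= p)%N -> (i + l <= n)%N ->
  minorI (Phi z) i l =
  \prod_(i <= r < p) (if (r < i + l)%N then getm z r (i + l).-1 else 1).
Proof.
move=> zGT ip il; rewrite -(minor_Wprod zGT (leqnn p)) ?subnn //.
Qed.

Lemma minor_Phi_neq0 z i l : inGT z -> (i <= p)%N -> (i + l <= n)%N ->
  minorI (Phi z) i l != 0.
Proof.
move=> zGT ip il; rewrite minor_Phi // big_nat.
apply: (big_ind (fun x : C => x != 0)) => [||r /andP[ir rp]].
- exact: oner_neq0.
- by move=> x y; exact: mulf_neq0.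
by case: ifP => rc; [apply: getm_inGT => //; lia | exact: oner_neq0].
Qed.

Lemma Psi_ok_Phi z : inGT z -> Psi_ok p (Phi z).
Proof.
by move=> zGT r c rc; split; apply: minor_Phi_neq0 => //;
  have := ltn_ord r; have := ltn_ord c; lia.
Qed.

(** The minors on rows [[r, c]] and [[r+1, c]] are the products of the entries of column [c] from
    row [r] and from row [r.+1] on, so their quotient is [z r c]. *)
Lemma PsiK z : inGT z -> Psi p (Phi z) = z.
Proof.
move=> zGT; apply/matrixP => r c; rewrite mxE; case: ifP => rc; last first.
  by rewrite (zGT r c).2 // ltnNge rc.
have hr := ltn_ord r; have hc := ltn_ord c.
have ok := (Psi_ok_Phi zGT rc).2.
apply: (mulIf ok); rewrite divfK // !minor_Phi //; [|lia..].
rewrite big_ltn // ifT; last by lia.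
congr (_ * _); last first.
  by apply: eq_big_nat => i _; have -> : (r + (c - r).+1 = r.+1 + (c - r))%N by lia.
by rewrite -[RHS]getmE; congr getm; lia.
Qed.

(** * The flow of a crystal operator and its velocity *)

Fixpoint push z j (a : C) s : C :=
  if s is s'.+1 then push_param (p.-1 - s') j (push z j a s') (Wargs z (p.-1 - s')) else a.

(** For [r <= j], the factor that turns the argument [Wargs z r j] back into the entry [z r j]. *)
Definition mu z j r := if (r < j)%N then getm z r j.-1 else 1.

(* The pattern reached from [z] by [\bar e_{j+1}^c] for [a = (c - 1) \bar\varphi_{j+1}],
   obtained by moving [x_{j+1}(a)] to the right through the factors of [Phi z]. *)
Definition flow z j a : 'M[C]_(p, n) := \matrix_(r, c)
  if (c == j :> nat) && (r <= j)%N then z r c + push z j a (p.-1 - r) * mu z j r else z r c.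

Lemma getm_flow z j a r c : (r < p)%N -> (c < n)%N ->
  getm (flow z j a) r c =
    if (c == j) && (r <= j)%N then getm z r c + push z j a (p.-1 - r) * mu z j r
    else getm z r c.
Proof.
move=> rp cn; rewrite [LHS](getmE _ (Ordinal rp) (Ordinal cn)) mxE /=.
by rewrite -[z _ _]getmE.
Qed.

Lemma Wargs_mu z j r : inGT z -> (j < n)%N -> (r < p)%N -> (r <= j)%N ->
  getm z r j = Wargs z r j * mu z j r /\ mu z j r != 0.
Proof.
move=> zGT jn rp rj; rewrite /Wargs /mu [j == r]eq_sym; case: ltngtP rj => // [rj|->] _.
  have nz : getm z r j.-1 != 0 by apply: getm_inGT => //; lia.
  by rewrite divfK.
by rewrite mulr1 oner_neq0.
Qed.

(** [push_args] preserves the product of the arguments [j] and [j.+1], hence the entry in column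
    [j.+1]; so changing the single entry in column [j] produces both new arguments. *)
Lemma Wargs_flow z j a r b : inGT z -> (j.+1 < n)%N -> (r < p)%N -> (r <= b < n)%N ->
  ((r <= j)%N -> Wargs z r j + push z j a (p.-1 - r) != 0) ->
  Wargs (flow z j a) r b = push_args r j (push z j a (p.-1 - r)) (Wargs z r) b.
Proof.
move=> zGT jn rp /andP[rb bn] ne; rewrite /push_args.
have [rj|jr] := leqP r j; last first.
  by rewrite /Wargs !getm_flow //; [rewrite leqNgt jr /= !andbF | lia..].
have [zj m0] := Wargs_mu zGT (ltnW jn) rp rj; have {}ne := ne rj.
have y0 := Wargs_neq0 zGT rp (ltnW jn) rj.
have [->|bj] := eqVneq b j.
  rewrite {1}/Wargs !getm_flow ?eqxx ?rj //=; [|lia..]; rewrite zj -mulrDl.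
  case: eqP => [jr|/eqP jr]; first by rewrite /mu jr ltnn mulr1.
  rewrite ifN /mu; last by lia.
  move: m0; rewrite /mu ifT; last by lia.
  by move=> m0; rewrite mulfK.
have [->|bj1] := eqVneq b j.+1.
  rewrite /= {1 2}/Wargs [j.+1 == r]gtn_eqF ?ltnS //= !getm_flow ?eqxx ?rj //=; [|lia..].
  rewrite ifN; last by lia.
  by rewrite zj; field; rewrite m0 y0 ne -mulrDl mulf_neq0.
rewrite /Wargs !getm_flow //; [|lia..].
rewrite (negbTE bj) /=; case: eqP => // /eqP br; rewrite ifN //; lia.
Qed.

(** [push z j a s] is the parameter of [x_j] after [s] factors. Row [r] belongs to factor number
    [p.-1 - r], counted from [0], which explains the index in [flow]. *)
Lemma xmx_mul_Wprod z j a k : inGT z -> (j.+1 < n)%N -> (k <= p)%N ->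
  (forall s : 'I_p, (p.-1 - s <= j)%N -> Wargs z (p.-1 - s) j + push z j a s != 0) ->
  xmx n j a *m Wprod z k = Wprod (flow z j a) k *m xmx n j (push z j a k).
Proof.
move=> zGT jn kp ne; elim: k kp => [|k IHk] kp.
  by rewrite /Wprod !big_ord0 mulmx1 mul1mx.
have {}ne := ne (Ordinal kp).
rewrite !WprodS mulmxA IHk; last by lia.
rewrite -!mulmxA; congr (_ *m _); rewrite xmx_mul_Wmx //; congr (_ *m _).
apply: Wmx_eq => b rb; rewrite Wargs_flow //; [|lia|];
  by rewrite (_ : p.-1 - (p.-1 - k) = k)%N //; lia.
Qed.

(** [kappa z j r * mu z j r] is the derivative of [push_param] at parameter [0], split so that
    [kappa] reads columns [j] and [j.+1] while [mu] reads column [j.-1]. *)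
Definition kappa z j r :=
  if (r <= j)%N then getm z r j.+1 / getm z r j ^+ 2
  else if r == j.+1 then getm z r r else 1.

Lemma kappa_neq0 z j r : inGT z -> (j.+1 < n)%N -> (r < p)%N -> kappa z j r != 0.
Proof.
move=> zGT jn rp; rewrite /kappa; case: (leqP r j) => rj.
  apply: mulf_neq0; rewrite ?invr_eq0 ?expf_neq0 //; apply: getm_inGT => //; lia.
case: (eqVneq r j.+1) => [_|_]; last exact: oner_neq0.
by apply: getm_inGT => //; lia.
Qed.

Lemma jet_push z j s : inGT z -> (j.+1 < n)%N -> (s <= p)%N ->
  jet (push z j ^~ s) 0 (\prod_(p - s <= r < p) (kappa z j r * mu z j r)).
Proof.
move=> zGT jn; elim: s => [|s IHs] sp.
  by rewrite subn0 big_geq //; exact: jet_id.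
have {}IHs := IHs (ltnW sp).
rewrite big_ltn; last by lia.
have e : (p - s = (p - s.+1).+1)%N by lia.
have e' : (p.-1 - s = p - s.+1)%N by lia.
rewrite -e /= e'; set r := (p - s.+1)%N; set d := \prod_(_ <= _ < _) _ in IHs *.
have rp : (r < p)%N by rewrite /r; lia.
rewrite /push_param /kappa; have [rj|jr] := leqP r j.
  have [zj m0] := Wargs_mu zGT (ltnW jn) rp rj.
  have y0 := Wargs_neq0 zGT rp (ltnW jn) rj.
  have J := jetD (jet_const (Wargs z r j)) IHs.
  have y0' : Wargs z r j + 0 != 0 by rewrite addr0.
  apply: jet_eq (jetM (jetM IHs (jet_const (Wargs z r j.+1))) (jetV J y0')) _ _.
    by rewrite !mul0r.
  have -> : Wargs z r j.+1 = getm z r j.+1 / getm z r j by rewrite /Wargs ifN //; lia.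
  by rewrite zj; field; rewrite ?addr0 m0 y0.
have -> : mu z j r = 1 by rewrite /mu ifN //; lia.
rewrite mulr1.
case: eqP => [->|_]; last by rewrite mul1r.
apply: jet_eq (jetM IHs (jet_const _)) _ _; first by rewrite mul0r.
by rewrite /Wargs eqxx mulr0 addr0 mulrC.
Qed.

(** The derivatives [kappa * mu] of the rows crossed before [r], times [mu] of [r] itself. *)
Definition velocity z j r :=
  (\prod_(r.+1 <= i < p) kappa z j i) * \prod_(r <= i < p) mu z j i.

Lemma jet_flow z j (r : 'I_p) (c : 'I_n) : inGT z -> (j.+1 < n)%N ->
  jet (fun a => flow z j a r c) (z r c)
    (if (c == j :> nat) && (r <= j)%N then velocity z j r else 0).
Proof.
move=> zGT jn; have rp := ltn_ord r.
case cj: ((c == j :> nat) && (r <= j)%N); last first.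
  by apply: jet_near (jet_const _) (near0T _) => a; rewrite mxE cj.
have h : (p.-1 - r <= p)%N by lia.
apply: jet_near (jet_eq (jetD (jet_const (z r c))
  (jetM (jet_push zGT jn h) (jet_const (mu z j r)))) _ _) (near0T _) => [||a].
- by rewrite mul0r addr0.
- rewrite mul0r addr0 add0r /velocity (_ : p - (p.-1 - r) = r.+1)%N; last by lia.
  by rewrite big_split /= [in RHS](big_ltn rp); ring.
by rewrite mxE cj.
Qed.

(** * Small flows are crystal operators *)

Definition nondeg z := forall i, (i.+1 < n)%N -> getm (Phi z) i.+1 i != 0.

Lemma Phi_diag_neq0 z j : inGT z -> (j < n)%N -> getm (Phi z) j j != 0.
Proof.
move=> zGT jn; rewrite -WprodE Wprod_diag // subnn big_nat.
apply: (big_ind (fun x : C => x != 0)) => [||r /andP[_ rp]].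
- exact: oner_neq0.
- by move=> x y; exact: mulf_neq0.
by rewrite /Wdiag; case: ltnP => [_|rj]; [exact: oner_neq0 | exact: Wargs_neq0].
Qed.

(** All requirements reduce to the nonvanishing of functions with a jet, which holds at [a = 0],
    where the flow is at [z]. *)
Lemma flow_near0 z j : inGT z -> nondeg z -> (j.+1 < n)%N ->
  near0 (fun a => [/\ inGT (flow z j a), nondeg (flow z j a) & ebar_step z (flow z j a)]).
Proof.
move=> zGT zN jn.
have near_ne : near0 (fun a => forall s : 'I_p, (p.-1 - s <= j)%N ->
    Wargs z (p.-1 - s) j + push z j a s != 0).
  apply: near0_all => s; have sp := ltn_ord s.
  have [rj|_] := leqP (p.-1 - s) j; last exact: near0T.
  have J := jetD (jet_const (Wargs z (p.-1 - s) j)) (jet_push zGT jn (ltnW sp)).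
  apply: near0W (jet_neq0 J _) => [//|]; rewrite addr0.
  by apply: Wargs_neq0 => //; lia.
have near_GT : near0 (fun a => inGT (flow z j a)).
  apply: near0_all => r; apply: near0_all => c; apply: near0I; last first.
    apply: near0T => a cr; rewrite mxE; have -> := (zGT r c).2 cr.
    by rewrite ifN //; lia.
  have [rc|_] := leqP r c; last exact: near0T.
  apply: near0W (jet_neq0 (jet_flow r c zGT jn) _) => [//|]; exact: (zGT r c).1.
set A := Phi z; pose B a := xmx n j a *m A.
have jetB i k : jet (fun a => getm (B a) i k) (getm A i k)
    (if i == j then getm A j.+1 k else 0).
  case: (eqVneq i j) => [ij|ij].
    apply: jet_near (jet_eq (jetD (jet_const (getm A i k))
      (jetM jet_id (jet_const (getm A j.+1 k)))) _ _) (near0T _) => [||a].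
    - by rewrite mul0r addr0.
    - by rewrite mulr0 addr0 add0r mul1r.
    by rewrite getm_xmx_mul // ij eqxx.
  apply: jet_near (jet_const (getm A i k)) (near0T _) => a.
  by rewrite getm_xmx_mul // (negbTE ij) addr0.
(* By [comm] below, these are the subdiagonal entries of [Phi (flow z j a)]: removing the right
   factor [x_j] from [B a] corrects column [j.+1] only. *)
have near_sub : near0 (fun a => forall i : 'I_n, (i.+1 < n)%N ->
    getm (B a) i.+1 i + (if i == j.+1 :> nat then - (push z j a p * getm (B a) i.+1 j) else 0)
    != 0).
  apply: near0_all => i; have [iN|_] := leqP i.+2 n; last exact: near0T.
  case: (eqVneq (i : nat) j.+1) => [_|_].
    have J := jetD (jetB i.+1 i) (jetM (jet_const (-1))
      (jetM (jet_push zGT jn (leqnn p)) (jetB i.+1 j))).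
    apply: near0W (jet_neq0 J _) => [a|]; first by rewrite mulN1r.
    by rewrite mul0r mulr0 addr0 zN.
  apply: near0W (jet_neq0 (jetB i.+1 i) _) => [a|]; first by rewrite addr0.
  exact: zN.
have phi0 : phib z j != 0.
  by apply: mulf_neq0; rewrite ?invr_eq0; [apply: Phi_diag_neq0 => //; lia | exact: zN].
have near_c : near0 (fun a => 1 + a * (phib z j)^-1 != 0).
  have J := jetD (jet_const 1) (jetM jet_id (jet_const (phib z j)^-1)).
  by apply: near0W (jet_neq0 J _) => //; rewrite mul0r addr0 oner_neq0.
apply: near0W (near0I (near0I near_ne near_GT) (near0I near_sub near_c)).
move=> a [[ne aGT] [sub c0]].
have comm : B a = Phi (flow z j a) *m xmx n j (push z j a p).
  by rewrite /B /A -!WprodE; apply: xmx_mul_Wprod.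
split=> // [i iN|].
  have := sub (Ordinal (ltnW iN)) iN; rewrite /= comm !getm_mul_xmx //.
  rewrite [j == _]ltn_eqF // addr0; case: (eqVneq i j.+1) => _; rewrite ?addr0 //.
  by rewrite addrK.
(* This [c] solves [(c - 1) * phib z j = a]. The two right factors [x_j] then disappear under
   [Psi]. *)
set c := 1 + a / phib z j in c0; exists j, c.
have step_mx : ebar_mx z j c = Phi (flow z j a) *m xmx n j (push z j a p)
    *m xmx n j ((c^-1 - 1) * epsb z j).
  by rewrite /ebar_mx -comm /B (_ : (c - 1) * phib z j = a) // /c; field.
split=> //; first by lia.
- split; first exact: zN.
  by rewrite step_mx; do 2!apply: Psi_ok_mul_xmx => //; apply: Psi_ok_Phi.
by rewrite /ebar step_mx !Psi_mul_xmx // PsiK.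
Qed.

(** * Reachable patterns and density in the fibers *)

Inductive reach k z : 'M[C]_(p, n) -> Prop :=
  | reach_refl : reach k z z
  | reach_flow z1 j a : reach k z z1 -> (j < k)%N -> inGT (flow z1 j a) ->
      nondeg (flow z1 j a) -> ebar_step z1 (flow z1 j a) -> reach k z (flow z1 j a).

Definition same_from k (z z' : 'M[C]_(p, n)) :=
  forall (r : 'I_p) (c : 'I_n), (k <= c)%N -> z r c = z' r c.

Definition vanishes_on_fiber k z (P : {mpoly C[p * n]}) :=
  forall w, inGT w -> same_from k w z -> evalpt P w = 0.

(** [reach_flow] carries both invariants, so [flow_near0] applies again at every reachable
    pattern. *)
Lemma reach_good k z z' : inGT z -> nondeg z -> reach k z z' -> inGT z' /\ nondeg z'.
Proof. by move=> zGT zN; case. Qed.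

Lemma reach_same k z z' : reach k z z' -> same_from k z' z.
Proof.
elim=> // z1 j a _ IH jk _ _ _ r c kc; rewrite mxE ifN ?IH //.
by apply: contraL kc => /andP[/eqP-> _]; rewrite -ltnNge.
Qed.

Lemma reach_le k k' z z' : (k <= k')%N -> reach k z z' -> reach k' z z'.
Proof.
move=> kk'; elim=> [|z1 j a _ IH jk]; first exact: reach_refl.
by apply: reach_flow => //; exact: leq_trans kk'.
Qed.

Lemma reach_trans k z z1 z2 : reach k z z1 -> reach k z1 z2 -> reach k z z2.
Proof. by move=> h; elim=> // z3 j a _ IH jk; exact: reach_flow. Qed.

Lemma reach_orbit k z z' : reach k z z' -> ebar_orbit z z'.
Proof.
elim=> [|z1 j a _ IH _ _ _]; [exact: orbit_refl | exact: orbit_step].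
Qed.

Lemma sum_mxvec (F : 'I_(p * n) -> C) :
  \sum_q F q = \sum_(r < p) \sum_(c < n) F (mxvec_index r c).
Proof.
rewrite pair_bigA /= (reindex _ (curry_mxvec_bij p n)) /=.
by apply: eq_bigr => -[].
Qed.

Lemma jet_evalpt (P : {mpoly C[p * n]}) (f : C -> 'M[C]_(p, n)) (v d : 'M[C]_(p, n)) :
  (forall r c, jet (fun a => f a r c) (v r c) (d r c)) ->
  jet (fun a => evalpt P (f a)) (evalpt P v)
    (\sum_r \sum_c d r c * evalpt P^`M(mxvec_index r c) v).
Proof.
move=> J; apply: jet_eq (@jet_meval _ P (fun q a => mxvec (f a) 0 q)
  (fun q => mxvec v 0 q) (fun q => mxvec d 0 q) _) _ _ => //.
  move=> q; case/mxvec_indexP: q => r c; rewrite !mxvecE.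
  by apply: jet_near (J r c) (near0T _) => a; rewrite mxvecE.
by rewrite sum_mxvec; apply: eq_bigr => r _; apply: eq_bigr => c _; rewrite mxvecE.
Qed.

(* By [jet_flow], moving [z2] along [flow z2 k] gives the relation
   [\sum_r velocity z2 k r * dP/dz_{r,k} (w) = 0]. Here [w] may be any point of the fiber, so
   the partial derivatives are constants while the entries of column [k - 1] of [z2] vary;
   setting these entries to [t] turns the relation into a polynomial in [t] whose
   coefficients are nonzero multiples of the partial derivatives. *)
Lemma vanishes_mderiv k z P (kn : (k < n)%N) (i : 'I_p) : (k.+1 < n)%N -> (i <= k)%N ->
  (forall z1 Q, inGT z1 -> nondeg z1 ->
    (forall z2, reach k z1 z2 -> evalpt Q z2 = 0) -> vanishes_on_fiber k z1 Q) ->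
  inGT z -> nondeg z ->
  (forall z1, reach k.+1 z z1 -> vanishes_on_fiber k z1 P) ->
  forall z1, reach k.+1 z z1 -> vanishes_on_fiber k z1 P^`M(mxvec_index i (Ordinal kn)).
Proof.
move=> k1n ik dense zGT zN IP z1 z_z1 w wGT w_z1.
have [z1GT z1N] := reach_good zGT zN z_z1.
have k'n : (k.-1 < n)%N by lia.
pose D r := evalpt P^`M(mxvec_index r (Ordinal kn)) w.
pose K (r : 'I_p) := \prod_(r.+1 <= s < p) kappa z1 k s.
have sameE (u : 'M[C]_(p, n)) r c : same_from k u z1 -> (k <= c)%N -> getm u r c = getm z1 r c.
  move=> u_z1 kc; have [rp|pr] := ltnP r p; last by rewrite !getm_out ?pr.
  have [cn|nc] := ltnP c n; last by rewrite !getm_out ?nc ?orbT.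
  by rewrite ![getm _ _ _](getmE _ (Ordinal rp) (Ordinal cn)); exact: u_z1.
(* The velocity relation as a polynomial in column [k.-1]: [D] and [K] are constant on the fiber, as
   [kappa] reads columns [k] and [k.+1] only. For [k = 0] no variable occurs. *)
pose G : {mpoly C[p * n]} := \sum_(r < p | (r <= k)%N) (D r * K r)%:MP *
  \prod_(s < p | (r <= s)%N)
    if (s < k)%N then 'X_(mxvec_index s (Ordinal k'n)) else 1.
have GE u : same_from k u z1 ->
    evalpt G u = \sum_(r < p | (r <= k)%N) D r * K r * \prod_(r <= s < p) mu u k s.
  move=> u_z1; rewrite /evalpt /G raddf_sum; apply: eq_bigr => r _ /=.
  rewrite mevalM mevalC rmorph_prod; congr (_ * _).
  rewrite [RHS]big_geq_mkord; apply: eq_bigr => s _; rewrite /mu.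
  case: ifP => _; last by rewrite rmorph1.
  by rewrite /= mevalXU mxvecE -[LHS]getmE.
have G0 u : reach k z1 u -> evalpt G u = 0.
  move=> z1_u; have [uGT uN] := reach_good z1GT z1N z1_u; have u_z1 := reach_same z1_u.
  (* Column [k] follows the flow of [u] and the rest is frozen at [w], so [v a] lies in the fiber of
     the reachable pattern [flow u k a]. *)
  pose v a : 'M[C]_(p, n) := \matrix_(r, c) if c == k :> nat then flow u k a r c else w r c.
  pose d : 'M[C]_(p, n) :=
    \matrix_(r, c) if (c == k :> nat) && (r <= k)%N then velocity u k r else 0.
  have Pv0 : near0 (fun a => evalpt P (v a) = 0).
    apply: near0W (flow_near0 uGT uN k1n) => a [fGT fN fstep].
    have zf : reach k.+1 z (flow u k a).
      apply: reach_flow (ltnSn k) fGT fN fstep.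
      by apply: reach_trans z_z1 _; exact: reach_le z1_u.
    apply: (IP _ zf) => r c; last first.
      rewrite mxE; case: eqP => // /eqP ck kc.
      by rewrite mxE (negbTE ck) /= u_z1 ?w_z1.
    by rewrite mxE; case: (eqVneq (c : nat) k) => _; [exact: fGT | exact: wGT].
  have J r c : jet (fun a => v a r c) (w r c) (d r c).
    have [ck|ck] := eqVneq (c : nat) k.
      apply: jet_near (jet_eq (jet_flow r c uGT k1n) _ _) (near0T _) => [||a].
      - by rewrite w_z1 ?u_z1 ?ck ?leqnn.
      - by rewrite mxE.
      by rewrite [RHS]mxE ck eqxx.
    rewrite mxE (negbTE ck); apply: jet_near (jet_const _) (near0T _) => a.
    by rewrite [RHS]mxE (negbTE ck).
  rewrite GE // -[RHS](jet_eq0 (jet_evalpt P J) Pv0) big_mkcond /=.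
  apply: eq_bigr => r _; rewrite (bigD1 (Ordinal kn)) //= mxE eqxx /= [X in _ + X]big1 => [|c].
    rewrite addr0; case: ifP => _; last by rewrite mul0r.
    rewrite /velocity -/(D r) [RHS]mulrC mulrA; congr (_ * _ * _).
    rewrite /K; apply: eq_bigr => s _; rewrite /kappa.
    rewrite !(sameE u _ k) ?(sameE u _ k.+1) //.
    case: ifP => // _; case: eqP => // ->; rewrite sameE //; exact: leqnSn.
  by rewrite -val_eqE /= mxE => /negbTE ->; rewrite mul0r.
have {}G0 := dense z1 G z1GT z1N G0.
pose u t : 'M[C]_(p, n) :=
  \matrix_(r, c) if (c.+1 == k :> nat) && (r <= c)%N then t else z1 r c.
(* The rows below [q] are those with an entry in column [k.-1], so at [u t] the monomial of row [r]
   is [t^(q - r)]. *)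
pose q := minn k p.
pose Q : {poly C} := \sum_(r < p | (r <= k)%N) (D r * K r) *: 'X^(q - r).
have Q0 : Q = 0.
  (* At [t = 0] the pattern [u t] may leave the torus; the factor [X] covers this value. *)
  suff : 'X * Q = 0 by move/eqP; rewrite mulf_eq0 polyX_eq0 => /eqP.
  apply: poly_vanish_eq0 => t; rewrite hornerM hornerX.
  have [->|t0] := eqVneq t 0; first by rewrite mul0r.
  have uGT : inGT (u t).
    move=> r c; rewrite mxE; case: ifP => [/andP[_ rc]|_]; last exact: z1GT.
    by split=> // cr; move: rc; rewrite leqNgt cr.
  have u_z1 : same_from k (u t) z1.
    by move=> r c kc; rewrite mxE ifN //; apply: contraL kc => /andP[/eqP<- _]; rewrite ltnn.
  rewrite -[RHS](mulr0 t) -(G0 _ uGT u_z1) GE //; congr (_ * _).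
  rewrite /Q horner_sum; apply: eq_bigr => r rk; rewrite hornerZ hornerXn; congr (_ * _).
  have rp := ltn_ord r; have rq : (r <= q <= p)%N by rewrite /q; lia.
  rewrite (@big_cat_nat _ _ _ q) /=; [|lia..].
  rewrite [X in _ * X]big_nat [X in _ * X]big1 ?mulr1 => [|s /andP[qs sp]]; last first.
    by rewrite /mu ifN //; move: qs; rewrite /q; lia.
  rewrite -prodr_const_nat big_nat [RHS]big_nat; apply: eq_bigr => s /andP[rs sq].
  have sk : (s < k)%N by move: sq; rewrite /q; lia.
  have sp : (s < p)%N by move: sq; rewrite /q; lia.
  rewrite /mu sk [RHS](getmE _ (Ordinal sp) (Ordinal k'n)) mxE /= ifT //; lia.
have K0 : K i != 0.
  rewrite /K big_nat; apply: (big_ind (fun x : C => x != 0)) => [||s /andP[_ sp]].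
  - exact: oner_neq0.
  - by move=> x y; exact: mulf_neq0.
  exact: kappa_neq0.
apply: (mulIf K0); rewrite mul0r -[LHS]/(D i * K i).
have := congr1 (fun R : {poly C} => R`_(q - i)) Q0.
rewrite coef0 /Q coef_sum (bigD1 i) //= coefZ coefXn eqxx mulr1 big1 ?addr0 // => r /andP[rk ri].
rewrite coefZ coefXn [_ == _](_ : _ = false) ?mulr0 //; move: ri; rewrite -val_eqE /= /q.
by have := ltn_ord r; have := ltn_ord i; lia.
Qed.

(** Induction on the degree: by [vanishes_mderiv] the derivatives along column [k] satisfy the same
    hypothesis, so [P] is constant on the line that moves column [k] from [z] to [w]. *)
Lemma vanishes_next k z P : (k.+1 < n)%N ->
  (forall z1 Q, inGT z1 -> nondeg z1 ->
    (forall z2, reach k z1 z2 -> evalpt Q z2 = 0) -> vanishes_on_fiber k z1 Q) ->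
  inGT z -> nondeg z ->
  (forall z1, reach k.+1 z z1 -> vanishes_on_fiber k z1 P) ->
  vanishes_on_fiber k.+1 z P.
Proof.
move=> k1n dense zGT zN; have kn := ltnW k1n.
move: {2}(msize P) (leqnn (msize P)) => d.
elim: d P => [|d IHd] P Pd IP w wGT w_z.
  by move: Pd; rewrite leqn0 msize_poly_eq0 => /eqP ->; rewrite /evalpt meval0.
pose w0 : 'M[C]_(p, n) := \matrix_(r, c) if c == k :> nat then z r c else w r c.
pose e : 'M[C]_(p, n) := \matrix_(r, c) if c == k :> nat then w r c - z r c else 0.
have w0GT : inGT w0.
  by move=> r c; rewrite mxE; case: (eqVneq (c : nat) k) => _; [exact: zGT | exact: wGT].
have Pw0 : evalpt P w0 = 0.
  apply: (IP z (reach_refl _ _)) => // r c kc; rewrite mxE; case: eqP => // /eqP ck.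
  by apply: w_z; lia.
pose h := mpoly_along (mxvec w0 0) (mxvec e 0) P.
have hE R t : (mpoly_along (mxvec w0 0) (mxvec e 0) R).[t] = evalpt R (w0 + t *: e).
  rewrite horner_along; apply: meval_eq => q; case/mxvec_indexP: q => r c.
  by rewrite !mxvecE !mxE mulrC.
have -> : w = w0 + 1 *: e.
  apply/matrixP => r c; rewrite !mxE mul1r; case: eqP => _; last by rewrite addr0.
  by rewrite addrC subrK.
rewrite -hE -/h (@deriv_eq0_horner h 1 0) ?hE ?scale0r ?addr0 //.
apply: near0_poly_eq0.
(* The line may leave the torus, but only at finitely many points, which is harmless for a
   polynomial derivative. *)
have GTt : near0 (fun t => inGT (w0 + t *: e)).
  apply: near0_all => r; apply: near0_all => c.
  have [cr|rc] := ltnP c r.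
    apply: near0T => t; split=> // _; rewrite !mxE.
    by rewrite (zGT r c).2 // (wGT r c).2 // subr0 !if_same mulr0 addr0.
  have J := jetD (jet_const (w0 r c)) (jetM jet_id (jet_const (e r c))).
  apply: near0W (jet_neq0 J _) => [t|]; first by rewrite !mxE.
  by rewrite mul0r addr0 (w0GT r c).1.
apply: near0W GTt => t GTt.
rewrite /h deriv_along horner_sum sum_mxvec big1 // => r _; apply: big1 => c _.
rewrite hornerZ hE mxvecE mxE; case: eqP => [ck|_]; last by rewrite mul0r.
have [rc|cr] := leqP r c; last by rewrite (zGT r c).2 // (wGT r c).2 // subrr mul0r.
have -> : c = Ordinal kn by apply: val_inj.
rewrite [X in _ * X](_ : _ = 0) ?mulr0 //; apply: IHd => //.
- by have := msize_mderiv P (mxvec_index r (Ordinal kn)); lia.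
- by apply: vanishes_mderiv => //; rewrite -ck.
move=> r' c' kc'; rewrite !mxE; case: eqP => [c'k|_]; first by lia.
by rewrite mulr0 addr0 w_z.
Qed.

(** For [k = 0] the fiber is the single pattern [z]; the step applies the induction hypothesis at
    each reachable pattern. *)
Lemma reach_dense k z P : (k < n)%N -> inGT z -> nondeg z ->
  (forall z', reach k z z' -> evalpt P z' = 0) -> vanishes_on_fiber k z P.
Proof.
elim: k z P => [|k IHk] z P kn zGT zN Pz.
  move=> w _ w_z; suff -> : w = z by apply: Pz; exact: reach_refl.
  by apply/matrixP => r c; exact: w_z.
have {}IHk z1 Q := IHk z1 Q (ltnW kn).
apply: vanishes_next => // z1 z_z1; have [z1GT z1N] := reach_good zGT zN z_z1.
apply: IHk => // z2 z1_z2; apply: Pz; apply: reach_trans z_z1 _; exact: reach_le z1_z2.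
Qed.

(* The entry [(j+1, j)] of [Phi z] is [S j * y j + D j] with [D j != 0], where
   [y j] is the [j]-th argument of the last factor and [S], [D] only involve the rows
   of [z] other than the first; so the first row can be chosen to make it nonzero. *)
Lemma exists_nondeg (omega : 'I_p -> C) : (0 < p)%N -> (forall r, omega r != 0) ->
  exists z : 'M[C]_(p, n), inGTw omega z /\ nondeg z.
Proof.
move=> p0 omega0.
pose z1 : 'M[C]_(p, n) := \matrix_(r, c)
  if (c < r)%N then 0 else if c == n.-1 :> nat then omega r else 1.
have z1GT : inGT z1.
  move=> r c; rewrite mxE; split=> [rc|->//]; rewrite ltnNge rc /=.
  by case: ifP => _; [exact: omega0 | exact: oner_neq0].
pose S j := getm (Wprod z1 p.-1) j.+1 j.
pose D j := getm (Wprod z1 p.-1) j.+1 j.+1.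
(* If [S j] is nonzero, [D j / S j] makes the entry [2 D j]; otherwise the entry is [D j]. The
   remaining branch keeps [y j] nonzero for every [j]. *)
pose y j := if S j == 0 then 1 else if D j == 0 then 1 else D j / S j.
have y0 j : y j != 0.
  rewrite /y; case: ifP => [_|/negbT s0]; first exact: oner_neq0.
  case: ifP => [_|/negbT d0]; first exact: oner_neq0.
  by rewrite mulf_neq0 ?invr_eq0.
have SD j : (j.+1 < n)%N -> S j * y j + D j != 0.
  move=> jn; have D0 : D j != 0.
    rewrite /D Wprod_diag //; last by lia.
    rewrite big_nat; apply: (big_ind (fun x : C => x != 0)) => [||r /andP[_ rp]].
    - exact: oner_neq0.
    - by move=> u v; exact: mulf_neq0.
    by rewrite /Wdiag; case: ltnP => [_|rj]; [exact: oner_neq0 | exact: Wargs_neq0].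
  rewrite /y (negbTE D0); have [->|S0] := eqVneq (S j) 0; first by rewrite mul0r add0r.
  by rewrite mulrC divfK // -mulr2n -mulr_natl mulf_neq0 // natrC_neq0.
(* Partial products in the first row give it the successive quotients [y], while the last column
   keeps the shape. *)
pose z : 'M[C]_(p, n) := \matrix_(r, c)
  if (r == 0 :> nat) && (c < n.-1)%N then \prod_(a < c.+1) y a else z1 r c.
have Y0 c : \prod_(a < c) y a != 0.
  by apply: (big_ind (fun x : C => x != 0)) => //; [exact: oner_neq0 | exact: mulf_neq0].
have zGT : inGT z.
  move=> r c; rewrite mxE; case: ifP => [/andP[/eqP r0 _]|_]; last exact: z1GT.
  by split=> // ; rewrite r0.
have zW : Wprod z p.-1 = Wprod z1 p.-1.
  apply: eq_bigr => s _; apply: Wmx_eq => b /andP[rb bn].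
  have zz1 c : getm z (p.-1 - s) c = getm z1 (p.-1 - s) c.
    have [cn|nc] := ltnP c n; last by rewrite !getm_out ?nc ?orbT.
    have rp : (p.-1 - s < p)%N by lia.
    rewrite ![getm _ _ _](getmE _ (Ordinal rp) (Ordinal cn)) mxE ifN //=.
    by have := ltn_ord s; lia.
  by rewrite /Wargs !zz1.
exists z; split.
  split=> // r c cn; have := ltn_ord r; rewrite !mxE cn ltnn andbF eqxx => rp.
  by rewrite ifN //; lia.
move=> j jn; rewrite -WprodE (_ : Wprod z p = Wprod z p.-1.+1); last by rewrite prednK.
rewrite WprodS subnn getm_mul_Wmx zW /=.
suff -> : Wargs z 0 j = y j by exact: SD.
have zE c : (c < n.-1)%N -> getm z 0 c = \prod_(a < c.+1) y a.
  move=> cn; have cn' : (c < n)%N by lia.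
  by rewrite (getmE _ (Ordinal p0) (Ordinal cn')) mxE /= cn.
rewrite /Wargs; case: (posnP j) => [->|j0]; rewrite ?zE; try lia.
  by rewrite big_ord1.
by rewrite prednK // big_ord_recr /= mulrC mulKf ?Y0.
Qed.

End Pattern.

Theorem theorem5p6 (m n : nat) (hm : (0 < m)%N) (hn : (0 < n)%N)
    (omega : 'I_(minn m n) -> C) (homega : forall r, omega r != 0) :
  exists z0 : 'M[C]_(minn m n, n),
    inGTw omega z0 /\ zariski_dense_in_GTw omega (ebar_orbit z0).
Proof.
have pn : (minn m n <= n)%N := geq_minr m n.
have p0 : (0 < minn m n)%N by rewrite leq_min hm.
have [z [z_omega zN]] := exists_nondeg pn p0 homega.
exists z; split=> // P Pz w [wGT w_omega].
have kn : (n.-1 < n)%N by rewrite prednK.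
(* The shape is column [n.-1], so the fiber for [k = n.-1] is the whole variety of patterns of shape
   [omega]. *)
apply: (reach_dense pn kn z_omega.1 zN) => // [z' /reach_orbit /Pz //|r c kc].
have cn : (c : nat) = n.-1 by have := ltn_ord c; lia.
by rewrite w_omega // z_omega.2.
Qed.
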